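(* Let $v=142396857\in S_9$ (one-line notation) and $\gamma=(4,6,3,3,0,0,0,0,0)$. Then $\#\mathrm{PD}(v,\gamma)=1$ and $\#\mathsf{GKKoh}(v,\gamma)\geq 2$.
   Context: Cells of the $n\times n$ grid $[n]\times[n]$ are indexed in matrix notation: $(i,j)$ is row $i$ (counted from the top), column $j$ (counted from the left). Pipe dreams. A pipe dream is a filling of the triangular grid $\{(i,j)\in[n]\times[n]: i+j\leq n\}$ with crossing tiles (a pipe entering from the top exits at the bottom, a pipe entering from the right exits at the left) and bump tiles (a pipe entering from the top exits at the left, a pipe entering from the right exits at the bottom); half-bump tiles (a pipe entering from the top exits at the left) are placed on the antidiagonal $i+j=n+1$. This gives $n$ pipes running from the top edge to the left edge. The permutation of a pipe dream: label the pipes $1,\dots,n$ along the top edge from left to right, trace them downwards and leftwards, ignoring any crossing between two pipes that have already crossed (treat such crossing tiles as bump tiles); the permutation $w$ is given by reading the labels along the left edge from top to bottom, as $w(1)w(2)\cdots w(n)$. (Equivalently, $w$ is the Demazure (0-Hecke) product of the $s_{i+j-1}$ over the crossing tiles $(i,j)$, read row by row from top to bottom and right to left within each row.) $\mathrm{PD}(w)$ is the set of pipe dreams with permutation $w$; $\mathrm{wt}(P)_i$ is the number of crossing tiles in row $i$ of $P$; $\mathrm{PD}(w,\alpha)=\{P\in\mathrm{PD}(w):\mathrm{wt}(P)=\alpha\}$. Rothe diagram. For $w\in S_n$, $D(w)=\{(i,j)\in[n]^2: i<w^{-1}(j),\ j<w(i)\}$. Grave diagrams and moves. A grave diagram is a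 pair $E=(B,G)$ of disjoint subsets of $[n]\times[n]$; cells of $B$ are boxes, cells of $G$ are ghosts, cells of $B\cup G$ are occupied. Its weight is $\mathrm{wt}(E)_i=\#\{j:(i,j)\in B\cup G\}$. (a) Suppose $(i,j)\in B$ is rightmost among all occupied cells in row $i$; let $i'=\max\{r: 1\leq r<i,\ (r,j)\notin B\cup G\}$; assume $i'$ exists and every occupied cell $(r,j)$ with $i'<r\leq i$ is a box. The ordinary Kohnert move at row $i$ is $(B,G)\mapsto((B\setminus\{(i,j)\})\cup\{(i',j)\},G)$. The $K$-Kohnert move at row $i$ is $(B,G)\mapsto((B\setminus\{(i,j)\})\cup\{(i',j)\},G\cup\{(i,j)\})$. (b) Suppose $(i,j)\in G$ is the rightmost occupied cell in row $i$; let $i'=\max\{r: 1\leq r<i,\ (r,j)\notin B\cup G\}$; assume $i'$ exists and every occupied cell $(r,j)$ with $i'<r<i$ is a ghost. The ghost Kohnert move at row $i$ is $(B,G)\mapsto(B,(G\setminus\{(i,j)\})\cup\{(i',j)\})$. The ghost $K$-Kohnert move at row $i$ is $(B,G)\mapsto(B,G\cup\{(i',j)\})$. $\mathsf{GKKoh}(w)$ is the closure of $(D(w),\varnothing)$ under ordinary, $K$-, ghost, and ghost $K$-Kohnert moves, i.e. the set of all grave diagrams obtainable from $(D(w),\varnothing)$ by finite sequences of such moves, and $\mathsf{GKKoh}(w,\alpha)=\{E\in\mathsf{GKKoh}(w):\mathrm{wt}(E)=\alpha\}$. *)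

(* Defs.v *)
From HB Require Import structures.
From mathcomp Require Import all_boot all_fingroup.

Set Implicit Arguments.
Unset Strict Implicit.
Unset Printing Implicit Defensive.

(* Rows and columns are ordinals, hence numbered from 0: the pair (i, j)
   denotes the cell in row i.+1 and column j.+1 of the n x n grid. *)
Notation cell n := ('I_n * 'I_n)%type.

Definition one_line n (w : 'S_n) : seq nat := [seq (w i).+1 | i <- enum 'I_n].

(* The triangular grid i + j <= n (1-based), i.e. i.+1 + j.+1 <= n (0-based). *)
Definition staircase n : {set cell n} := [set c : cell n | c.1.+1 + c.2.+1 <= n].

(* [trace_row tiles tops X] traces the pipes through one row, right to left.
   - [tops]: the labels of the pipes entering the row from the top, from left
     to right; the last of them meets the half-bump tile of the row;
   - [tiles]: which tiles of the row, from left to right, are crossing tiles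
     (entries beyond the half-bump tile are not looked at);
   - [X]: the pairs of pipes that have already crossed.
   It returns the label of the pipe exiting on the left edge, the labels of
   the pipes exiting at the bottom, and the updated set of crossed pairs.
   In the recursive case, the leftmost tile receives the pipe [a] from the top
   and the pipe [h] from the right. *)
Fixpoint trace_row (tiles : seq bool) (tops : seq nat) (X : seq (nat * nat)) :
    nat * seq nat * seq (nat * nat) :=
  match tops with
  | [::] => (0, [::], X)
  | [:: a] => (a, [::], X)
  | a :: tops' =>
      let: (h, bottoms, X1) := trace_row (behead tiles) tops' X in
      let crossed := ((a, h) \in X1) || ((h, a) \in X1) in
      if head false tiles && ~~ crossed then (h, a :: bottoms, (a, h) :: X1)
      else (a, h :: bottoms, X1)
  end.

Fixpoint trace_rows (rows : seq (seq bool)) (tops : seq nat)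
    (X : seq (nat * nat)) : seq nat :=
  if rows is tiles :: rows' then
    let: (h, bottoms, X1) := trace_row tiles tops X in
    h :: trace_rows rows' bottoms X1
  else [::].

(* A filling of the staircase is given by its set P of crossing tiles; the
   pipes are labelled 1, ..., n along the top edge, and [pd_word P] is the word
   read along the left edge from top to bottom. *)
Definition pd_word n (P : {set cell n}) : seq nat :=
  trace_rows [seq [seq (i, j) \in P | j <- enum 'I_n] | i <- enum 'I_n]
    (iota 1 n) [::].

Definition PD n (w : 'S_n) : {set {set cell n}} :=
  [set P : {set cell n} | (P \subset staircase n) && (pd_word P == one_line w)].

Definition row_weight n (A : {set cell n}) : n.-tuple nat :=
  [tuple #|[set j | (i, j) \in A]| | i < n].

Definition PD_wt n (w : 'S_n) (alpha : n.-tuple nat) : {set {set cell n}} :=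
  [set P in PD w | row_weight P == alpha].

Definition rothe n (w : 'S_n) : {set cell n} :=
  [set c : cell n | (c.1 < (w^-1)%g c.2) && (c.2 < w c.1)].

Definition grave n : finType :=
  {E : {set cell n} * {set cell n} | [disjoint E.1 & E.2]}.

Definition boxes n (E : grave n) : {set cell n} := (val E).1.
Definition ghosts n (E : grave n) : {set cell n} := (val E).2.
Definition occupied n (E : grave n) : {set cell n} := boxes E :|: ghosts E.

Definition grave_wt n (E : grave n) : n.-tuple nat := row_weight (occupied E).

Definition rightmost n (E : grave n) (i j : 'I_n) : bool :=
  ((i, j) \in occupied E) &&
  [forall j' : 'I_n, ((i, j') \in occupied E) ==> (j' <= j)].

(* i' = max {r < i : (r, j) is not occupied}; in particular the maximum exists. *)
Definition landing_row n (E : grave n) (i j i' : 'I_n) : bool :=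
  [&& i' < i, (i', j) \notin occupied E &
    [forall r : 'I_n, (r < i) && ((r, j) \notin occupied E) ==> (r <= i')]].

Definition box_movable n (E : grave n) (i j i' : 'I_n) : bool :=
  [&& (i, j) \in boxes E, rightmost E i j, landing_row E i j i' &
    [forall r : 'I_n, (i' < r <= i) && ((r, j) \in occupied E)
                        ==> ((r, j) \in boxes E)]].

Definition ghost_movable n (E : grave n) (i j i' : 'I_n) : bool :=
  [&& (i, j) \in ghosts E, rightmost E i j, landing_row E i j i' &
    [forall r : 'I_n, (i' < r < i) && ((r, j) \in occupied E)
                        ==> ((r, j) \in ghosts E)]].

Definition kohnert_move n (E E' : grave n) : bool :=
  [exists i : 'I_n, exists j : 'I_n, exists i' : 'I_n,
    [&& box_movable E i j i',
        boxes E' == (i', j) |: (boxes E :\ (i, j)) &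
        ghosts E' == ghosts E]].

Definition K_kohnert_move n (E E' : grave n) : bool :=
  [exists i : 'I_n, exists j : 'I_n, exists i' : 'I_n,
    [&& box_movable E i j i',
        boxes E' == (i', j) |: (boxes E :\ (i, j)) &
        ghosts E' == (i, j) |: ghosts E]].

Definition ghost_kohnert_move n (E E' : grave n) : bool :=
  [exists i : 'I_n, exists j : 'I_n, exists i' : 'I_n,
    [&& ghost_movable E i j i',
        boxes E' == boxes E &
        ghosts E' == (i', j) |: (ghosts E :\ (i, j))]].

Definition ghost_K_kohnert_move n (E E' : grave n) : bool :=
  [exists i : 'I_n, exists j : 'I_n, exists i' : 'I_n,
    [&& ghost_movable E i j i',
        boxes E' == boxes E &
        ghosts E' == (i', j) |: ghosts E]].

Definition grave_move n : rel (grave n) := fun E E' =>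
  [|| kohnert_move E E', K_kohnert_move E E',
      ghost_kohnert_move E E' | ghost_K_kohnert_move E E'].

Lemma disjoint_rothe0 n (w : 'S_n) : [disjoint rothe w & (set0 : {set cell n})].
Proof. by rewrite -setI_eq0 setI0. Qed.

Definition rothe_grave n (w : 'S_n) : grave n :=
  exist (fun E : {set cell n} * {set cell n} => [disjoint E.1 & E.2] : bool)
    (rothe w, set0) (disjoint_rothe0 w).

Definition GKKoh n (w : 'S_n) : {set grave n} :=
  [set E | connect (@grave_move n) (rothe_grave w) E].

Definition GKKoh_wt n (w : 'S_n) (alpha : n.-tuple nat) : {set grave n} :=
  [set E in GKKoh w | grave_wt E == alpha].

Definition v_fun (i : 'I_9) : 'I_9 :=
  inord (nth 0 [:: 1; 4; 2; 3; 9; 6; 8; 5; 7] i).-1.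

Lemma v_fun_inj : injective v_fun.
Proof.
move=> [i Hi] [j Hj] /(congr1 val) /=; rewrite !inordK.
- move=> e; apply/val_inj => /=; move: Hi Hj e.
  by do 9?[case: i => [|i]]; do 9?[case: j => [|j]].
- by move: Hj; do 9?[case: j => [|j]].
- by move: Hi; do 9?[case: i => [|i]].
Qed.

Definition v142396857 : 'S_9 := perm v_fun_inj.

Lemma one_line_v142396857 : one_line v142396857 = [:: 1; 4; 2; 3; 9; 6; 8; 5; 7].
Proof.
transitivity [seq nth 0 [:: 1; 4; 2; 3; 9; 6; 8; 5; 7] i | i <- map val (enum 'I_9)].
  rewrite -map_comp; apply: eq_map => -[i Hi]; rewrite permE /v_fun /= inordK.
  - by move: Hi; do 9?[case: i => [|i]].
  - by move: Hi; do 9?[case: i => [|i]].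
by rewrite val_enum_ord.
Qed.

(* Main.v *)
(** Both counts are finite verifications. The label leaving row [i] of a pipe
    dream on the left depends only on rows 1, ..., [i], so a row-by-row
    backtracking search, keeping only the prefixes that produce the prescribed
    word, finds every pipe dream of weight gamma: there is exactly one. For grave
    diagrams two explicit sequences of moves lead from the Rothe diagram to
    two diagrams of weight gamma that differ in cell (3, 5). *)

Require Import Defs.
From mathcomp Require Import all_boot all_fingroup.

Set Implicit Arguments.
Unset Strict Implicit.
Unset Printing Implicit Defensive.

(** * Finite sets of cells given by boolean functions on coordinates *)

Definition nat_set n (f : nat -> nat -> bool) : {set cell n} :=
  [set c : cell n | f c.1 c.2].

Lemma map_enum_ord T n (f : nat -> T) :
  [seq f (i : 'I_n) | i <- enum 'I_n] = [seq f i | i <- iota 0 n].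
Proof. by rewrite -val_enum_ord -map_comp. Qed.

Lemma card_ord_count n (p : pred nat) :
  #|[set j : 'I_n | p j]| = count p (iota 0 n).
Proof.
rewrite cardE /enum_mem size_filter -val_enum_ord count_map enumT.
by apply: eq_count => j; rewrite /= inE.
Qed.

Lemma val_row_weight_nat_set n f :
  row_weight (nat_set n f) = [seq count (f i) (iota 0 n) | i <- iota 0 n] :> seq nat.
Proof.
rewrite /= -map_enum_ord; apply: eq_map => i.
by rewrite -card_ord_count; apply: eq_card => j; rewrite !inE.
Qed.

Lemma all_ord n (p : pred nat) (i : 'I_n) : all p (iota 0 n) -> p i.
Proof. by move/allP; apply; rewrite mem_iota /=. Qed.

(** * Exhaustive search for pipe dreams *)

Definition pd_tiles n (P : {set cell n}) : seq (seq bool) :=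
  [seq [seq (i, j) \in P | j <- enum 'I_n] | i <- enum 'I_n].

Lemma pd_tiles_inj n : injective (@pd_tiles n).
Proof.
move=> P Q /eq_in_map eqPQ; apply/setP=> -[i j].
by have /eq_in_map/(_ j (mem_enum _ _)) := eqPQ i (mem_enum _ _).
Qed.

Lemma pd_tiles_nat_set n f :
  pd_tiles (nat_set n f) = [seq [seq f i j | j <- iota 0 n] | i <- iota 0 n].
Proof.
rewrite -map_enum_ord.
apply: eq_map => i; rewrite -map_enum_ord.
by apply: eq_map => j; rewrite inE.
Qed.

(** The [a] crossings lie among the first [m] tiles; padding to length [n] gives the same shape as a
    row of [pd_tiles]. *)
Definition row_fillings (n m a : nat) : seq (seq bool) :=
  [seq t ++ nseq (n - m) false
     | t <- permutations (nseq a true ++ nseq (m - a) false)].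

(** Two boolean words with equally many entries of each value are permutations of each other, so
    only counts matter once the tail is known to be constant. *)
Lemma mem_row_fillings n m (r : seq bool) :
    size r = n -> m <= n -> (forall j, m <= j -> nth false r j = false) ->
  r \in row_fillings n m (count id r).
Proof.
move=> sz_r le_mn r0; have drop_r: drop m r = nseq (n - m) false.
  apply: (@eq_from_nth _ false) => [|j _]; first by rewrite size_drop size_nseq sz_r.
  by rewrite nth_drop r0 ?leq_addr // nth_nseq if_same.
have count_r: count id (take m r) = count id r.
  by rewrite -[in RHS](cat_take_drop m r) count_cat drop_r count_nseq addn0.
have sz_take: size (take m r) = m by rewrite size_take_min sz_r; apply/minn_idPl.
apply/mapP; exists (take m r); last by rewrite -drop_r cat_take_drop.
rewrite mem_permutations; apply/allP => /= x _; apply/eqP.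
rewrite count_cat !count_nseq -count_r; case: x => /=.
  by rewrite addn0 mul1n; apply: eq_count => -[].
rewrite mul0n mul1n add0n -[X in X - _]sz_take -(count_predC id) addKn.
by apply: eq_count => -[].
Qed.

Fixpoint pd_search (cands : seq (seq (seq bool))) (word tops : seq nat)
    (X : seq (nat * nat)) : seq (seq (seq bool)) :=
  match cands, word with
  | c :: cands', h :: word' =>
      flatten
        [seq (let: (h', bottoms, X1) := trace_row t tops X in
              if h' == h then
                [seq t :: rows | rows <- pd_search cands' word' bottoms X1]
              else [::]) | t <- c]
  | [::], [::] => [:: [::]]
  | _, _ => [::]
  end.

(** Completeness of the search: along [rows] itself every exit label agrees with the word, so this
    branch is never cut. *)
Lemma mem_pd_search rows cands tops X :
    all2 (fun (t : seq bool) c => t \in c) rows cands ->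
  rows \in pd_search cands (trace_rows rows tops X) tops X.
Proof.
elim: rows cands tops X => [|t rows IH] [|c cands] tops X //= /andP[tc all_rows].
case E: (trace_row t tops X) => [[h bottoms] X1] /=.
apply/flatten_mapP; exists t => //; rewrite E eqxx.
by apply/mapP; exists rows => //; apply: IH.
Qed.

(** Row [i], counted from 0, meets the staircase in its first [n - i.+1] cells. *)
Definition pd_candidates n (alpha : seq nat) : seq (seq (seq bool)) :=
  [seq row_fillings n (n - i.+1) (nth 0 alpha i) | i <- iota 0 n].

Lemma pd_tiles_search n (P : {set cell n}) : P \subset staircase n ->
  pd_tiles P \in pd_search (pd_candidates n (row_weight P)) (pd_word P) (iota 1 n) [::].
Proof.
move=> /subsetP stP.
have row_mem (i : 'I_n) : [seq (i, j) \in P | j <- enum 'I_n]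
    \in row_fillings n (n - i.+1) (nth 0 (row_weight P) i); last first.
  apply: mem_pd_search; rewrite /pd_candidates -map_enum_ord.
  have all2_rows (s : seq 'I_n) : all2 (fun (t : seq bool) c => t \in c)
      [seq [seq (i, j) \in P | j <- enum 'I_n] | i <- s]
      [seq row_fillings n (n - (i : 'I_n).+1) (nth 0 (row_weight P) i) | i <- s].
    by elim: s => //= i s ->; rewrite row_mem.
  exact: all2_rows.
set r := map _ _.
have sz_r: size r = n by rewrite size_map size_enum_ord.
have -> : nth 0 [seq #|[set j | (i', j) \in P]| | i' <- enum 'I_n] i = count id r.
  rewrite (nth_map i) ?size_enum_ord // nth_ord_enum count_map enumT.
  by rewrite cardE /enum_mem size_filter; apply: eq_count => j; rewrite /= inE.
apply: mem_row_fillings; rewrite ?leq_subr // => j le_j.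
case: (ltnP j n) => [lt_j | le_nj]; last by rewrite nth_default ?sz_r.
rewrite (nth_map i) ?size_enum_ord //.
apply: contraTF le_j => /stP; rewrite inE /= nth_enum_ord //.
by rewrite -ltnNge ltn_subRL addnS.
Qed.

(** * Grave diagrams as functions on coordinates *)

(** Such functions can be evaluated, and boxes and ghosts are disjoint by construction. *)
Definition grid := nat -> nat -> option bool.

Definition has_tile (k : bool) (g : grid) (i j : nat) : bool := g i j == Some k.

Lemma disjoint_has_tile n g :
  [disjoint nat_set n (has_tile true g) & nat_set n (has_tile false g)].
Proof.
rewrite -setI_eq0; apply/eqP/setP=> c; rewrite !inE /has_tile.
by case: (g _ _) => [[]|].
Qed.

(* [Some true] is a box and [Some false] a ghost. *)
Definition grid_grave n (g : grid) : grave n :=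
  exist (fun E : {set cell n} * {set cell n} => [disjoint E.1 & E.2] : bool)
    (nat_set n (has_tile true g), nat_set n (has_tile false g))
    (disjoint_has_tile n g).

Lemma grid_grave_box n g g' : grid_grave n g = grid_grave n g' ->
  forall i j : 'I_n, has_tile true g i j = has_tile true g' i j.
Proof. by case=> /setP eq_box _ i j; have := eq_box (i, j); rewrite !inE. Qed.

Lemma occupied_grid_grave n g :
  occupied (grid_grave n g) = nat_set n (fun i j => isSome (g i j)).
Proof.
by apply/setP=> c; rewrite !inE /has_tile; case: (g _ _) => [[]|].
Qed.

Definition upd (g : grid) (i j : nat) (x : option bool) : grid :=
  fun a b => if (a == i) && (b == j) then x else g a b.

(* A move [(keep, i, j, i')] sends the tile in cell (i, j) to cell (i', j),
   leaving a ghost behind if [keep] is set (the K-moves). *)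
Notation gmove := (bool * nat * nat * nat)%type.

Definition apply_move (g : grid) (m : gmove) : grid :=
  let: (keep, i, j, i') := m in
  upd (upd g i j (if keep then Some false else None)) i' j (g i j).

(** The last condition makes every cell strictly between the two rows occupied by the kind of tile
    that moves. This forces [i'] to be the maximal empty row and covers boxes and ghosts at once. *)
Definition legal_move n (g : grid) (m : gmove) : bool :=
  let: (keep, i, j, i') := m in
  [&& i < n, j < n, i' < i, isSome (g i j),
      all (fun j' => ~~ g i j') (iota j.+1 (n - j.+1)), ~~ g i' j &
      all (fun r => g r j == g i j) (iota i'.+1 (i - i'.+1))].

Lemma legal_grave_move n g m : legal_move n g m ->
  grave_move (grid_grave n g) (grid_grave n (apply_move g m)).
Proof.
case: m => [[[keep i0] j0] i0'] /and5P[lt_in lt_jn lt_i'i].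
move=> g_ij /and3P[/allP right0 g_i'j /allP between].
pose i := Ordinal lt_in; pose j := Ordinal lt_jn.
pose i' := Ordinal (ltn_trans lt_i'i lt_in).
have rm: rightmost (grid_grave n g) i j.
  rewrite /rightmost occupied_grid_grave inE g_ij; apply/forallP=> j'.
  rewrite inE /=; apply/implyP; apply: contraTT; rewrite -ltnNge => lt_jj'.
  by apply: right0; rewrite mem_iota lt_jj' subnKC ?ltn_ord.
have same (r : 'I_n) : i' < r < i -> g r j = g i j.
  by move=> /andP[lt_i'r lt_ri]; apply/eqP/between; rewrite mem_iota lt_i'r subnKC.
have land: landing_row (grid_grave n g) i j i'.
  rewrite /landing_row occupied_grid_grave !inE lt_i'i g_i'j; apply/forallP=> r.
  rewrite inE; apply/implyP=> /andP[lt_ri]; apply: contraR; rewrite -ltnNge => lt_i'r.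
  by rewrite /= same ?lt_i'r.
have i'_neq_i: (i0' == i0) = false by rewrite ltn_eqF.
case g_k: (g i0 j0) g_ij => [k|] // _.
have movable: (if k then box_movable else ghost_movable) n (grid_grave n g) i j i'.
  case: k g_k => g_k; rewrite /box_movable /ghost_movable rm land inE /has_tile g_k /=.
    apply/forallP=> r; apply/implyP=> /andP[/andP[lt_i'r le_ri] _]; rewrite inE /has_tile /=.
    move: le_ri; rewrite leq_eqVlt => /orP[/eqP-> | lt_ri]; first by rewrite g_k.
    by rewrite same ?lt_i'r // g_k.
  by apply/forallP=> r; apply/implyP=> /andP[lt_r _]; rewrite inE /has_tile /= same ?g_k.
(* One statement covers the four moves: [k] tells box from ghost, [keep] tells K-moves from the
   others. *)
suff: [&& (if k then box_movable else ghost_movable) n (grid_grave n g) i j i',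
   boxes (grid_grave n (apply_move g (keep, i0, j0, i0'))) ==
     (if k then (i', j) |: (boxes (grid_grave n g) :\ (i, j)) else boxes (grid_grave n g)) &
   ghosts (grid_grave n (apply_move g (keep, i0, j0, i0'))) ==
     (if k then (if keep then (i, j) |: ghosts (grid_grave n g) else ghosts (grid_grave n g))
      else (i', j) |: (if keep then ghosts (grid_grave n g)
                       else ghosts (grid_grave n g) :\ (i, j)))].
  move=> mv; rewrite /grave_move.
  case: k keep g_k movable mv => -[] _ _ mv; apply/or4P;
    [constructor 2 | constructor 1 | constructor 4 | constructor 3];
    by apply/existsP; exists i; apply/existsP; exists j; apply/existsP; exists i'.
(* Cell by cell: only the target and source cells can change, and the target was empty. *)
rewrite movable /=; apply/andP; split; apply/eqP/setP=> -[a b];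
  case: k g_k {movable} => g_k; case: keep;
  rewrite !inE /has_tile /= /upd g_k ?xpair_eqE -?val_eqE /=;
  case: (altP (a =P i0' :> nat)) => [-> | _] /=; rewrite ?i'_neq_i;
  case: (altP (b =P j0 :> nat)) => [-> | _] //=; rewrite ?(negPf g_i'j) ?andbT ?andbF //;
  try (by case: (g i0' j0) g_i'j); case: (altP (a =P i0 :> nat)) => [-> | _] //=;
  by rewrite g_k.
Qed.

Fixpoint legal_moves n (g : grid) (ms : seq gmove) : bool :=
  if ms is m :: ms' then legal_move n g m && legal_moves n (apply_move g m) ms'
  else true.

Lemma connect_legal_moves n g ms : legal_moves n g ms ->
  connect (@grave_move n) (grid_grave n g) (grid_grave n (foldl apply_move g ms)).
Proof.
elim: ms g => [|m ms IH] g /=; first by rewrite connect0.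
move=> /andP[/legal_grave_move/connect1 gm /IH]; exact: connect_trans.
Qed.

(** Entries of a one-line word start at 1, so [index j.+1 s] is the inverse permutation at [j],
    counted from 0. *)
Definition rothe_grid (s : seq nat) : grid := fun i j =>
  if (i < index j.+1 s) && (j.+1 < nth 0 s i) then Some true else None.

Lemma rothe_grave_grid n (w : 'S_n) :
  rothe_grave w = grid_grave n (rothe_grid (one_line w)).
Proof.
have nth_w (i : 'I_n) : nth 0 (one_line w) i = (w i).+1.
  by rewrite (nth_map i) ?size_enum_ord // nth_ord_enum.
have index_w (j : 'I_n) : index j.+1 (one_line w) = (w^-1)%g j.
  rewrite -{1}(permKV w j) (@index_map _ _ (fun i : 'I_n => (w i).+1)) ?index_enum_ord //.
  by move=> x y [] /val_inj/perm_inj.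
apply/val_inj; congr pair; apply/setP=> -[i j];
  by rewrite !inE /has_tile /rothe_grid /= index_w nth_w ltnS; case: ifP.
Qed.

(** * The permutation 142396857 *)

(* Found by computer search. The first four rows of the diagrams reached by
   [moves1] and [moves2] are (# box, o ghost; the other rows are empty)
     . . # . # . # # .        . . # . # . # # .
     . # o . o # # o .        . # o . # # # o .
     . . . . # o o . .        . . . . o o o . .
     . . . . # o o . .        . . . . # o o . . *)
Definition common_moves : seq gmove := [::
  (true, 6, 6, 5); (false, 5, 6, 3); (false, 6, 6, 5); (false, 6, 4, 3);
   (true, 4, 7, 3); (false, 3, 7, 2); (false, 4, 7, 3); (false, 4, 6, 2);
   (true, 4, 5, 3); (false, 5, 6, 4); (false, 5, 4, 2); (false, 2, 7, 1);
   (false, 3, 7, 2); (false, 3, 6, 1); (false, 3, 5, 2) ].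

Definition moves1 : seq gmove := common_moves ++ [::
  (false, 4, 6, 3); (false, 4, 5, 3); (false, 1, 7, 0); (false, 1, 6, 0);
   (true, 1, 2, 0); (false, 4, 4, 1); (true, 1, 4, 0); (false, 2, 7, 1);
   (false, 2, 6, 1); (true, 2, 5, 1); (true, 3, 6, 2) ].

Definition moves2 : seq gmove := common_moves ++ [::
  (true, 3, 4, 1); (true, 4, 6, 3); (false, 1, 7, 0); (false, 1, 6, 0);
   (false, 1, 4, 0); (true, 1, 2, 0); (false, 2, 7, 1); (false, 2, 6, 1);
   (false, 2, 5, 1); (false, 2, 4, 1); (false, 3, 6, 2); (false, 3, 4, 2);
   (false, 4, 6, 3); (true, 4, 5, 3); (false, 4, 5, 2); (false, 4, 4, 3) ].

Theorem proposition3p8 :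
  let gamma : 9.-tuple nat := [tuple 4; 6; 3; 3; 0; 0; 0; 0; 0] in
  #|PD_wt v142396857 gamma| = 1 /\ 2 <= #|GKKoh_wt v142396857 gamma|.
Proof.
move=> gamma; split.
  (* The crossing columns, counted from 0, of the only pipe dream; the default [[::]] leaves the
     later rows empty. *)
  pose f (i j : nat) :=
    j \in nth [::] [:: [:: 2; 4; 6; 7]; [:: 0; 1; 3; 4; 5; 6]; [:: 2; 3; 5]; [:: 1; 3; 4]] i.
  apply/eqP/cards1P; exists (nat_set 9 f); apply/setP=> P; rewrite in_set1 !inE.
  apply/andP/eqP=> [[/andP[stP /eqP wP] /eqP wtP] | ->].
    have := pd_tiles_search stP.
    rewrite wP wtP one_line_v142396857 => tilesP.
    apply: pd_tiles_inj; rewrite pd_tiles_nat_set; apply/eqP.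
    (* The search evaluates to a one-element list. *)
    by rewrite -mem_seq1; move: tilesP; vm_compute (pd_search _ _ _ _).
  split; last by apply/eqP/val_inj; rewrite [LHS]val_row_weight_nat_set.
  rewrite one_line_v142396857 /pd_word -/(pd_tiles _) pd_tiles_nat_set andbC.
  apply/andP; split; first by vm_compute.
  apply/subsetP=> -[i j]; rewrite !inE /=; apply/implyP.
  apply: (@all_ord 9 (fun j => f i j ==> (i.+1 + j.+1 <= 9)) j).
  by apply: (@all_ord 9 (fun i => all (fun j => f i j ==> (i.+1 + j.+1 <= 9)) (iota 0 9)) i).
pose E ms := grid_grave 9 (foldl apply_move (rothe_grid (one_line v142396857)) ms).
(* With the word written out, legality and weight become a closed boolean, decided by evaluation. *)
have E_mem ms : let g := rothe_grid [:: 1; 4; 2; 3; 9; 6; 8; 5; 7] in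
    legal_moves 9 g ms &&
    ([seq count (fun j => isSome (foldl apply_move g ms i j)) (iota 0 9) | i <- iota 0 9]
       == val gamma) ->
    E ms \in GKKoh_wt v142396857 gamma.
  rewrite /E one_line_v142396857 => /andP[legal /eqP wt_ms].
  rewrite !inE rothe_grave_grid one_line_v142396857 connect_legal_moves //=.
  apply/eqP/val_inj; rewrite /grave_wt occupied_grid_grave.
  by rewrite [LHS]val_row_weight_nat_set wt_ms.
apply/card_gt1P; exists (E moves1), (E moves2); split.
- by apply: E_mem; vm_compute.
- by apply: E_mem; vm_compute.
rewrite /E one_line_v142396857.
(* Cell (3, 5), counted from 1, is a box in the first diagram and a ghost in the second. *)
apply/eqP=> /grid_grave_box/(_ (@Ordinal 9 2 isT) (@Ordinal 9 4 isT)).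
by vm_compute.
Qed.
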